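(* Let $C$ be a binary singly even self-dual $[82,41,14]$ code with shadow $S$. Suppose that, for some integers $\alpha,\beta$, one of the following holds (the dots denote terms of higher degree): (i) $S$ has minimum weight $5$, and $$W_C=1+( 3280 + 2 \beta )y^{14}+( 36244 + 128 \alpha - 2 \beta )y^{16}+( 506153 - 896 \alpha - 26 \beta )y^{18}+ \cdots,$$ $$W_S=y^5+(- 18 + \alpha) y^9+( 153 - 16 \alpha - \beta) y^{13}+( 303568 + 120 \alpha + 14 \beta) y^{17}+ \cdots;$$ (ii) $S$ has minimum weight at least $9$, and $$W_C=1+( 3280 + 2 \beta )y^{14}+( 36244 + 128 \alpha - 2 \beta )y^{16}+( 514345 - 896 \alpha - 26 \beta )y^{18}+ \cdots,$$ $$W_S=\alpha y^9+( - 16 \alpha - \beta )y^{13}+( 304384 + 120 \alpha + 14 \beta )y^{17}+( 33293312 - 560 \alpha - 91 \beta )y^{21}+ \cdots.$$ Then $\beta$ is an even integer.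
   Context: All codes are binary: a code of length $n$ is a subspace of $\mathbb{F}_2^n$, and $[n,k,d]$ denotes length $n$, dimension $k$, minimum weight $d$. A code $C$ is self-dual if $C=C^\perp$ with respect to the standard inner product. A self-dual code is singly even if it contains a codeword of weight $\equiv 2 \pmod 4$. For a singly even self-dual code $C$, let $C_0$ be the subcode of codewords of weight $\equiv 0 \pmod 4$; the shadow of $C$ is $S=C_0^\perp\setminus C$. The weight enumerators are $W_C=\sum_i A_i y^i$ and $W_S=\sum_i B_i y^i$, where $A_i$ and $B_i$ are the numbers of vectors of weight $i$ in $C$ and $S$, respectively. Every singly even self-dual $[82,41,14]$ code with shadow of minimum weight $5$ (resp. at least $9$) has weight enumerators of the form in (i) (resp. (ii)) for some integers $\alpha,\beta$. *)

(* Defs.v *)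
From mathcomp Require Import all_boot all_algebra.

Set Implicit Arguments.
Unset Strict Implicit.
Unset Printing Implicit Defensive.

Import GRing.Theory.
Local Open Scope ring_scope.

Definition wt n (v : 'rV['F_2]_n) : nat := #|[set i | v 0 i != 0]|.

Definition dotp n (u v : 'rV['F_2]_n) : 'F_2 := \sum_(i < n) u 0 i * v 0 i.

Definition dual n (A : {set 'rV['F_2]_n}) : {set 'rV['F_2]_n} :=
  [set u | [forall v in A, dotp u v == 0]].

Definition codewords n (C : {vspace 'rV['F_2]_n}) : {set 'rV['F_2]_n} :=
  [set v in C].

(* The zero vector is disregarded, as usual for linear codes; a shadow never
   contains it, so the same notion serves for shadows. *)
Definition has_min_weight n (A : {set 'rV['F_2]_n}) (d : nat) : Prop :=
  (exists2 v, v \in A & v != 0 /\ wt v = d) /\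
  (forall v, v \in A -> v != 0 -> (d <= wt v)%N).

Definition linear_code n (k d : nat) (C : {vspace 'rV['F_2]_n}) : Prop :=
  \dim C = k /\ has_min_weight (codewords C) d.

Definition self_dual n (C : {vspace 'rV['F_2]_n}) : Prop :=
  codewords C = dual (codewords C).

Definition singly_even n (C : {vspace 'rV['F_2]_n}) : Prop :=
  exists2 v, v \in C & wt v = 2 %[mod 4].

Definition doubly_even_part n (C : {vspace 'rV['F_2]_n}) :
    {set 'rV['F_2]_n} :=
  [set v in C | (4 %| wt v)%N].

Definition shadow n (C : {vspace 'rV['F_2]_n}) : {set 'rV['F_2]_n} :=
  dual (doubly_even_part C) :\: codewords C.

Definition weight_enum n (A : {set 'rV['F_2]_n}) : {poly int} :=
  \poly_(i < n.+1) (#|[set v in A | wt v == i]|)%:Z.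

(* [W =_(d) p] is the reading of [W = p + ...], where the dots stand for terms
   of degree greater than [d], the last exponent written out in [p]. *)
Definition agree_upto (d : nat) (W p : {poly int}) : Prop :=
  forall i, (i <= d)%N -> W`_i = p`_i.

Notation "W '=_(' d ) p" := (agree_upto d W p)
  (at level 70, d at level 50, p at level 69) : ring_scope.

(* Main.v *)
(* Fix s in the shadow S of C. For v in S the sign (-1)^(s.v) tells apart the two
   cosets of C_0 that make up S, so the numbers d_j = sum_{v in S, wt v = j} (-1)^(s.v)
   are the coefficients of the difference D of their weight enumerators, and d_j has
   the parity of B_j. Since s.s = 1, the MacWilliams transform maps D to -D; moreover
   d_(82-j) = -d_j, and d_j = 0 unless j = 1 mod 4. With d_1 = 0 these linear conditions
   force d_13 = -14 d_9 - 105 d_5, whence B_13 = B_5 mod 2, and the coefficients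
   B_5, B_13 of W_S then give the parity of beta. *)
Require Import Defs.
From mathcomp Require Import all_boot all_algebra finfield zify ring.
Set Implicit Arguments.
Unset Strict Implicit.
Unset Printing Implicit Defensive.
Import GRing.Theory.
Local Open Scope ring_scope.

(** * Signs, inner products and weights over ['F_2] *)

Lemma F2_cases (a : 'F_2) : a = 0 \/ a = 1.
Proof. by case: a => [[|[|m]] Hm] //; [left | right]; apply: val_inj. Qed.

Lemma natr_F2_eq0 (m : nat) : (m%:R == 0 :> 'F_2) = ~~ odd m.
Proof. by rewrite -(dvdn_pcharf (pchar_Fp (isT : prime 2))) dvdn2. Qed.

Definition sgn (a : 'F_2) : int := if a == 0 then 1 else -1.

Lemma sgnD (a b : 'F_2) : sgn (a + b) = sgn a * sgn b.
Proof. by case: (F2_cases a) => ->; case: (F2_cases b) => ->. Qed.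

Lemma dotpC n (u v : 'rV['F_2]_n) : dotp u v = dotp v u.
Proof. by apply: eq_bigr => i _; rewrite mulrC. Qed.

Lemma dotpDl n (u v w : 'rV['F_2]_n) : dotp (u + v) w = dotp u w + dotp v w.
Proof. by rewrite -big_split; apply: eq_bigr => i _; rewrite mxE mulrDl. Qed.

Lemma dotpDr n (u v w : 'rV['F_2]_n) : dotp w (u + v) = dotp w u + dotp w v.
Proof. by rewrite !(dotpC w) dotpDl. Qed.

Lemma addvv_F2 n (u : 'rV['F_2]_n) : u + u = 0.
Proof.
by apply/rowP=> i; rewrite !mxE; case: (F2_cases (u 0 i)) => ->; apply: val_inj.
Qed.

Definition overlap n (u v : 'rV['F_2]_n) : nat :=
  (\sum_(i < n) (u 0%R i != 0%R) * (v 0%R i != 0%R))%N.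

Lemma wtE n (v : 'rV['F_2]_n) : wt v = (\sum_(i < n) (v 0%R i != 0%R))%N.
Proof. by rewrite /wt cardsE -sum1_card big_mkcond. Qed.

Lemma wt_le n (v : 'rV['F_2]_n) : (wt v <= n)%N.
Proof. by rewrite -[X in (_ <= X)%N]card_ord max_card. Qed.

Lemma wtD n (u v : 'rV['F_2]_n) :
  (wt (u + v) + 2 * overlap u v = wt u + wt v)%N.
Proof.
rewrite !wtE /overlap big_distrr -!big_split; apply: eq_bigr => i _ /=; rewrite mxE.
by case: (F2_cases (u 0 i)) => ->; case: (F2_cases (v 0 i)) => ->.
Qed.

Lemma dotp_eq0 n (u v : 'rV['F_2]_n) : (dotp u v == 0) = ~~ odd (overlap u v).
Proof.
rewrite -natr_F2_eq0 natr_sum; congr (_ == 0); apply: eq_bigr => i _.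
by case: (F2_cases (u 0 i)) => ->; case: (F2_cases (v 0 i)) => ->; apply: val_inj.
Qed.

Lemma overlapvv n (v : 'rV['F_2]_n) : overlap v v = wt v.
Proof. by rewrite wtE; apply: eq_bigr => i _; rewrite mulnb andbb. Qed.

(** * Self-dual codes and their shadows *)

Lemma self_dual_dotp n (C : {vspace 'rV['F_2]_n}) (u v : 'rV['F_2]_n) :
  self_dual C -> u \in C -> v \in C -> dotp u v = 0.
Proof.
move=> sdC uC vC; have: u \in dual (codewords C) by rewrite -sdC inE.
by rewrite inE => /forall_inP/(_ v); rewrite inE => /(_ vC)/eqP.
Qed.

Lemma self_dual_memP n (C : {vspace 'rV['F_2]_n}) (u : 'rV['F_2]_n) :
  self_dual C -> {in C, forall v, dotp u v = 0} -> u \in C.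
Proof.
move=> sdC uC; have: u \in dual (codewords C); last by rewrite -sdC inE.
by rewrite inE; apply/forall_inP=> v; rewrite inE => /uC ->.
Qed.

Lemma self_dual_wt_even n (C : {vspace 'rV['F_2]_n}) (v : 'rV['F_2]_n) :
  self_dual C -> v \in C -> ~~ odd (wt v).
Proof. by move=> sdC vC; rewrite -overlapvv -dotp_eq0 (self_dual_dotp sdC). Qed.

(** Orthogonality makes the overlap even, so weight is additive mod 4 on C, with values 0 and 2;
    hence C_0 has index at most 2 in C. *)
Lemma self_dual_wtD n (C : {vspace 'rV['F_2]_n}) (u v : 'rV['F_2]_n) :
  self_dual C -> u \in C -> v \in C ->
  (4 %| wt (u + v))%N = ((4 %| wt u) == (4 %| wt v))%N.
Proof.
move=> sdC uC vC; have := wtD u v.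
have: ~~ odd (overlap u v) by rewrite -dotp_eq0 (self_dual_dotp sdC).
have := self_dual_wt_even sdC uC; have := self_dual_wt_even sdC vC; lia.
Qed.

Lemma shadowP n (C : {vspace 'rV['F_2]_n}) (s : 'rV['F_2]_n) :
  reflect (s \notin C /\ {in C, forall c, (4 %| wt c)%N -> dotp s c = 0})
    (s \in shadow C).
Proof.
rewrite 3!inE; apply: (iffP andP) => -[sC s0]; split=> //.
  by move=> c cC c4; apply/eqP/(forall_inP s0); rewrite !inE cC.
by apply/forall_inP=> c; rewrite !inE => /andP[cC c4]; rewrite s0.
Qed.

(** If the functional of s vanished at some c outside C_0, it would vanish on C_0 and on c + C_0,
    hence on all of C, putting s in the dual of C, which is C. *)
Lemma shadow_dotp n (C : {vspace 'rV['F_2]_n}) (s c : 'rV['F_2]_n) :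
  self_dual C -> s \in shadow C -> c \in C -> (dotp s c == 0) = (4 %| wt c)%N.
Proof.
move=> sdC /shadowP[sC s0] cC; apply/idP/idP => [/eqP sc0|c4]; last by rewrite s0.
apply: contraNT sC => c4; apply: (self_dual_memP sdC) => v vC.
have [v4|v4] := boolP (4 %| wt v)%N; first exact: s0.
rewrite -[RHS](s0 (c + v)) ?rpredD // ?(self_dual_wtD sdC) ?dotpDr ?sc0 ?add0r //.
by rewrite (negPf c4) (negPf v4).
Qed.

(** All shadow vectors induce the same functional on C, so their differences are orthogonal to C and
    lie in C: S is the coset s + C. *)
Lemma shadow_coset n (C : {vspace 'rV['F_2]_n}) (s u : 'rV['F_2]_n) :
  self_dual C -> s \in shadow C -> (u \in shadow C) = (s + u \in C).
Proof.
move=> sdC sS; apply/idP/idP => [uS|suC].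
  apply: (self_dual_memP sdC) => c cC; rewrite dotpDl.
  have := shadow_dotp sdC sS cC; have := shadow_dotp sdC uS cC.
  by case: (F2_cases (dotp s c)) (F2_cases (dotp u c)) => [] -> [] -> // <- // _;
    apply: val_inj.
have -> : u = s + (s + u) by rewrite addrA addvv_F2 add0r.
have /shadowP[sC s0] := sS; apply/shadowP; split=> [|c cC c4].
  by rewrite rpredDr.
by rewrite dotpDl s0 // (self_dual_dotp sdC) ?addr0.
Qed.

(** With c = s + u in C, wt u = wt s + wt c - 2 [overlap s c], and the last two terms cancel mod 4:
    the overlap is even exactly when 4 divides wt c. *)
Lemma shadow_wt_mod4 n (C : {vspace 'rV['F_2]_n}) (s u : 'rV['F_2]_n) :
  self_dual C -> s \in shadow C -> u \in shadow C -> wt u = wt s %[mod 4].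
Proof.
move=> sdC sS uS; have cC : s + u \in C by rewrite -(shadow_coset _ sdC sS).
have := shadow_dotp sdC sS cC; rewrite dotp_eq0.
have := self_dual_wt_even sdC cC; have := wtD s (s + u).
by rewrite addrA addvv_F2 add0r; lia.
Qed.

Lemma dotp_ones n (v : 'rV['F_2]_n) : dotp (const_mx 1) v = dotp v v.
Proof.
apply: eq_bigr => i _; rewrite mxE.
by case: (F2_cases (v 0 i)) => ->; apply: val_inj.
Qed.

Lemma self_dual_ones n (C : {vspace 'rV['F_2]_n}) :
  self_dual C -> const_mx 1 \in C.
Proof.
move=> sdC; apply: (self_dual_memP sdC) => c cC.
by rewrite dotp_ones (self_dual_dotp sdC).
Qed.

Lemma wt_complement n (v : 'rV['F_2]_n) : (wt (const_mx 1 + v)%R = n - wt v)%N.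
Proof.
suff: (wt (const_mx 1 + v)%R + wt v = n)%N by lia.
rewrite !wtE -big_split -[RHS]card_ord -sum1_card; apply: eq_bigr => i _ /=.
by rewrite !mxE; case: (F2_cases (v 0 i)) => ->.
Qed.

(** * Character sums and the Fourier transform of the weight *)

Lemma card_code n (C : {vspace 'rV['F_2]_n}) : #|C|%:Z = 2 ^+ \dim C.
Proof. by rewrite card_vspace card_Fp // -natz natrX. Qed.

Lemma sum_sgn n (C : {vspace 'rV['F_2]_n}) (w : 'rV['F_2]_n) :
  self_dual C ->
  \sum_(c in C) sgn (dotp w c) = if w \in C then #|C|%:Z else 0.
Proof.
move=> sdC; case: ifPn => wC.
  rewrite (eq_bigr (fun=> 1)) => [|c cC]; last by rewrite (self_dual_dotp sdC).
  by rewrite sumr_const natz.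
have /exists_inP[c0 c0C wc0] : [exists c in C, dotp w c != 0].
  apply: contraNT wC => /exists_inPn wC; apply: (self_dual_memP sdC) => c cC.
  by apply/eqP; have := wC c cC; rewrite negbK.
(* Translation by c0 permutes C and flips every sign. *)
suff: \sum_(c in C) sgn (dotp w c) = - \sum_(c in C) sgn (dotp w c) by lia.
rewrite {1}(reindex_inj (addrI c0)) -sumrN; apply: eq_big => [c|c _].
  by rewrite rpredDl.
by rewrite dotpDr sgnD [sgn (dotp w c0)]/sgn (negPf wc0) mulN1r.
Qed.

Lemma prod_wt n (x y : int) (v : 'rV['F_2]_n) :
  \prod_(i < n) (if v 0 i == 0 then x else y) = x ^+ (n - wt v) * y ^+ wt v.
Proof.
have -> : (n - wt v)%N = (\sum_(i < n) (v 0%R i == 0%R))%N.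
  suff: (\sum_(i < n) (v 0%R i == 0%R) + wt v = n)%N by lia.
  rewrite wtE -big_split -[RHS]card_ord -sum1_card; apply: eq_bigr => i _ /=.
  by case: eqP.
rewrite wtE -!prodrXr -big_split; apply: eq_bigr => i _ /=.
by case: eqP; rewrite ?mulr1 ?mul1r.
Qed.

(** The summand is a product over coordinates, so the sum factors; a coordinate contributes x + y
    where v is 0 and x - y where v is 1. *)
Lemma fourier_wt n (x y : int) (v : 'rV['F_2]_n) :
  \sum_(u : 'rV['F_2]_n) sgn (dotp u v) * (x ^+ (n - wt u) * y ^+ wt u)
    = (x + y) ^+ (n - wt v) * (x - y) ^+ wt v.
Proof.
pose F i (a : 'F_2) := sgn (a * v 0 i) * (if a == 0 then x else y).
rewrite -prod_wt (eq_bigr (fun i => \sum_a F i a)) => [|i _].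
  rewrite bigA_distr_bigA /= (reindex (fun u : 'rV_n => [ffun i => u 0 i])) /=.
    apply: eq_bigr => u _; under eq_bigr do rewrite /F ffunE.
    rewrite big_split prod_wt /=; congr (_ * _).
    rewrite /dotp; exact: (big_morph sgn sgnD).
  exists (fun f : {ffun 'I_n -> 'F_2} => \row_i f i) => [u _|f _].
    by apply/rowP=> i; rewrite mxE ffunE.
  by apply/ffunP=> i; rewrite ffunE mxE.
rewrite (bigD1 0) //= (bigD1 1) //= big1 => [|a]; last first.
  by case: (F2_cases a) => ->.
by rewrite /F mul0r mul1r; case: (F2_cases (v 0 i)) => ->; rewrite /sgn /=; ring.
Qed.

(** * The signed weight distribution of the shadow and its symmetries *)

Definition signed_count n (C : {vspace 'rV['F_2]_n}) (s : 'rV['F_2]_n) (j : nat) : int :=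
  \sum_(v in shadow C | wt v == j) sgn (dotp s v).

Lemma sum_signed_count n (C : {vspace 'rV['F_2]_n}) (s : 'rV['F_2]_n) (G : nat -> int) :
  \sum_(v in shadow C) sgn (dotp s v) * G (wt v) =
  \sum_(j < n.+1) signed_count C s j * G j.
Proof.
rewrite (partition_big (fun v => inord (wt v) : 'I_n.+1) xpredT) //=.
apply: eq_bigr => j _; rewrite mulr_suml; apply: eq_big => [v|v].
  by rewrite -val_eqE /= inordK // ltnS wt_le.
by case/andP=> _ /eqP <-; rewrite inordK // ltnS wt_le.
Qed.

(** After the Fourier expansion and an exchange of sums, the inner sum over v in S of the sign of (s
    + u).v vanishes unless s + u is in C, that is, u is in S. The factor -1 is the sign of s.s =
    1. *)
Lemma shadow_macwilliams n (C : {vspace 'rV['F_2]_n}) (s : 'rV['F_2]_n) (x y : int) :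
  self_dual C -> s \in shadow C -> odd (wt s) ->
  \sum_(j < n.+1) signed_count C s j * ((x + y) ^+ (n - j) * (x - y) ^+ j) =
  - #|C|%:Z * \sum_(j < n.+1) signed_count C s j * (x ^+ (n - j) * y ^+ j).
Proof.
move=> sdC sS s_odd.
pose G (x y : int) j := x ^+ (n - j) * y ^+ j.
rewrite -(sum_signed_count C s (G (x + y) (x - y))) -(sum_signed_count C s (G x y)).
have sumS (w : 'rV_n) : \sum_(v in shadow C) sgn (dotp w v) =
    sgn (dotp w s) * (if w \in C then #|C|%:Z else 0).
  rewrite -(sum_sgn w sdC) mulr_sumr (reindex_inj (addrI s)).
  apply: eq_big => [c|c _]; last by rewrite dotpDr sgnD.
  by rewrite (shadow_coset _ sdC sS) addrA addvv_F2 add0r.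
under eq_bigr => v _ do rewrite /G -fourier_wt mulr_sumr.
rewrite exchange_big mulr_sumr [RHS]big_mkcond; apply: eq_bigr => u _ /=.
under eq_bigr => v _ do rewrite mulrA -sgnD -dotpDl.
rewrite -mulr_suml sumS -(shadow_coset _ sdC sS) dotpDl sgnD.
have -> : sgn (dotp s s) = -1 by rewrite /sgn dotp_eq0 overlapvv s_odd.
rewrite /G (dotpC u); move: (x ^+ _ * _) (sgn _) #|C|%:Z => a b c.
by case: ifP => _; ring.
Qed.

(** Adding the all-ones vector, which lies in C, preserves S and complements weights; it flips the
    sign because s.1 = s.s = 1. *)
Lemma signed_count_complement n (C : {vspace 'rV['F_2]_n}) (s : 'rV['F_2]_n) (j : nat) :
  self_dual C -> s \in shadow C -> odd (wt s) -> (j <= n)%N ->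
  signed_count C s (n - j) = - signed_count C s j.
Proof.
move=> sdC sS s_odd jn; have C1 := self_dual_ones sdC.
rewrite /signed_count (reindex_inj (addrI (const_mx 1))) -sumrN.
have s1 : sgn (dotp s (const_mx 1)) = -1.
  by rewrite dotpC dotp_ones /sgn dotp_eq0 overlapvv s_odd.
apply: eq_big => [v|v _]; last by rewrite dotpDr sgnD s1 mulN1r.
rewrite !(shadow_coset _ sdC sS) addrCA rpredDl // wt_complement.
by have := wt_le v; case: (_ \in C) => //=; lia.
Qed.

Lemma signed_count_mod2 n (C : {vspace 'rV['F_2]_n}) (s : 'rV['F_2]_n) (j : nat) :
  (2 %| signed_count C s j - #|[set v in shadow C | wt v == j]|%:Z)%Z.
Proof.
rewrite cardsE -sum1_card -[X in _ - X]natz natr_sum -sumrB rpred_sum // => v _.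
by rewrite /sgn; case: ifP.
Qed.

(* By Gleason-type theory D = f^5 h E^2 (b E^3 + c f^4) with f = xy(x^4 - y^4),
   h = x^12 - 33 x^8 y^4 - 33 x^4 y^8 + y^12 and E = x^8 + 14 x^4 y^4 + y^8, which is
   where the relation comes from. Here it is obtained instead by evaluating the
   transform at seven integer points, enough to make the linear system for
   d_13, ..., d_37 determined by d_5 and d_9. *)
Lemma macwilliams82_relation (d : nat -> int) :
  (forall j, j %% 4 != 1 -> d j = 0)%N ->
  (forall j, (j <= 82)%N -> d (82 - j)%N = - d j) -> d 1%N = 0 ->
  (forall x y : int, \sum_(j < 83) d j * ((x + y) ^+ (82 - j) * (x - y) ^+ j)
     = - 2 ^+ 41 * \sum_(j < 83) d j * (x ^+ (82 - j) * y ^+ j)) ->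
  d 13%N = - 14 * d 9%N - 105 * d 5%N.
Proof.
move=> d4 dC d1 M.
(* The pairs (j, 82 - j) with j = 1 mod 4, without 1 and 81, where d vanishes, and the self-paired
   exponent 41. *)
pose J := [:: (5, 77); (9, 73); (13, 69); (17, 65); (21, 61); (25, 57);
              (29, 53); (33, 49); (37, 45)]%N.
have sumE (F : nat -> nat -> int) : \sum_(j < 83) d j * F (82 - j)%N j =
    \sum_(k <- J) d k.1 * (F k.2 k.1 - F k.1 k.2).
  transitivity (\sum_(j <- [:: 1; 41; 81] ++ unzip1 J ++ unzip2 J)
                  d j * F (82 - j)%N j).
    rewrite -(big_mkord xpredT (fun j => d j * F (82 - j)%N j)).
    rewrite (bigID (fun j => j %% 4 == 1)%N) /= [X in _ + X]big1 => [|j /d4 ->].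
      by rewrite addr0 -big_filter; apply: perm_big.
    by rewrite mul0r.
  (* Since 82 - 41 = 41, antisymmetry gives d_41 = - d_41. *)
  have d41 : d 41%N = 0 by have := dC 41%N isT : d 41%N = _; lia.
  rewrite 2!big_cat /unzip1 /unzip2 !big_map 3!big_cons big_nil /=.
  rewrite (dC 1%N isT : d 81%N = _) d1 d41.
  rewrite oppr0 !mul0r !add0r -big_split !big_seq.
  apply: eq_bigr => -[j k] /= jJ.
  have /andP[j82 /eqP->] : (j <= 82)%N && (k == 82 - j)%N.
    exact: (allP (isT : all (fun p => (p.1 <= 82)%N && (p.2 == 82 - p.1)%N) J)) jJ.
  by rewrite dC // subKn //; ring.
pose g (x y : int) i j := x ^+ i * y ^+ j.
have E x y :
    \sum_(k <- J) d k.1 *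
      (g (x + y) (x - y) k.2 k.1 - g (x + y) (x - y) k.1 k.2) =
    - 2 ^+ 41 * \sum_(k <- J) d k.1 * (g x y k.2 k.1 - g x y k.1 k.2).
  by rewrite -!sumE; exact: M.
(* Unfolding the sum over [J] makes each instance of [E] at numerals an explicit linear equation in
   the d_j, within reach of [lia]. *)
rewrite /J unlock /= /g in E.
move: (E 2 1) (E 3 2) (E 4 1) (E 4 3) (E 5 2) (E 7 2) (E 7 4).
lia.
Qed.

(** * Parity of the shadow counts, and the conclusion for beta *)

Lemma shadow_count_parity (C : {vspace 'rV['F_2]_82}) (s : 'rV['F_2]_82) :
  self_dual C -> \dim C = 41%N -> s \in shadow C -> wt s = 1 %[mod 4] ->
  #|[set v in shadow C | wt v == 1%N]| = 0%N ->
  odd #|[set v in shadow C | wt v == 13%N]| =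
    odd #|[set v in shadow C | wt v == 5%N]|.
Proof.
move=> sdC dimC sS s1 B1.
have s_odd : odd (wt s) by lia.
have := signed_count_mod2 C s 5%N; have := signed_count_mod2 C s 13%N.
(* As 14 is even and 105 is odd, the relation gives d_13 = d_5 mod 2. *)
suff -> : signed_count C s 13%N =
    - 14 * signed_count C s 9%N - 105 * signed_count C s 5%N by lia.
apply: macwilliams82_relation => [j j1|j j82||x y].
- apply: big_pred0 => v; apply: contraNF j1 => /andP[vS /eqP <-].
  by rewrite (shadow_wt_mod4 sdC sS vS) s1.
- exact: signed_count_complement.
- apply: big_pred0 => v; move/eqP: B1; rewrite cards_eq0 => /eqP/setP/(_ v).
  by rewrite !inE.
by rewrite (shadow_macwilliams _ _ sdC sS s_odd) card_code dimC.
Qed.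

Lemma coef_weight_enum n (A : {set 'rV['F_2]_n}) (i : nat) :
  (weight_enum A)`_i = #|[set v in A | wt v == i]|%:Z.
Proof.
rewrite coef_poly ltnS; case: leqP => // ni; congr Posz; apply/esym/eqP.
rewrite cards_eq0; apply/eqP/setP=> v; rewrite !inE; apply/negbTE/nandP; right.
by have := wt_le v; lia.
Qed.

Lemma agree_upto_dropr (d k : nat) (W p : {poly int}) (c : int) :
  W =_(d) p + c *: 'X^k ->
  forall m, (m <= d)%N -> (m < k)%N -> W =_(m) p.
Proof.
move=> Wp m md mk i im; rewrite Wp ?(leq_trans im) //.
by rewrite coefD coefZ coefXn ltn_eqF ?(leq_ltn_trans im) // mulr0 addr0.
Qed.

Theorem proposition2 (C : {vspace 'rV['F_2]_82}) (alpha beta : int) :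
  linear_code 41 14 C -> self_dual C -> singly_even C ->
  [/\ has_min_weight (shadow C) 5,
      weight_enum (codewords C) =_(18)
        1 + (3280 + 2 * beta) *: 'X^14
          + (36244%:R + 128 * alpha - 2 * beta) *: 'X^16
          + (506153%:R - 896 * alpha - 26 * beta) *: 'X^18
    & weight_enum (shadow C) =_(17)
        'X^5 + (- 18 + alpha) *: 'X^9
          + (153 - 16 * alpha - beta) *: 'X^13
          + (303568%:R + 120 * alpha + 14 * beta) *: 'X^17]
  \/
  [/\ exists2 d, (9 <= d)%N & has_min_weight (shadow C) d,
      weight_enum (codewords C) =_(18)
        1 + (3280 + 2 * beta) *: 'X^14
          + (36244%:R + 128 * alpha - 2 * beta) *: 'X^16
          + (514345%:R - 896 * alpha - 26 * beta) *: 'X^18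
    & weight_enum (shadow C) =_(21)
        alpha *: 'X^9
          + (- 16 * alpha - beta) *: 'X^13
          + (304384%:R + 120 * alpha + 14 * beta) *: 'X^17
          + (33293312%:R - 560 * alpha - 91 * beta) *: 'X^21] ->
  (2 %| beta)%Z.
Proof.
move=> [dimC _] sdC _ H.
have parity s := shadow_count_parity sdC dimC (s := s).
pose B (i : nat) : nat := #|[set v in shadow C | wt v == i]|.
have coefB i : (B i)%:Z = (weight_enum (shadow C))`_i.
  by rewrite coef_weight_enum.
have parityB s : s \in shadow C -> wt s = 1 %[mod 4] -> (B 1%N)%:Z = 0 ->
    odd (B 13%N) = odd (B 5%N).
  by move=> sS s1 [B1]; apply: (parity s).
case: H => -[Smin _ /agree_upto_dropr].
  (* Only B_1, B_5 and B_13 matter here, so the term of degree 17 is dropped. *)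
  move=> /(_ 16%N isT isT) WS.
  have B1 : (B 1%N)%:Z = 0 by rewrite coefB WS // !coefE /=; ring.
  have B5 : (B 5%N)%:Z = 1 by rewrite coefB WS // !coefE /=; ring.
  have B13 : (B 13%N)%:Z = 153 - 16 * alpha - beta.
    by rewrite coefB WS // !coefE /=; ring.
  (* A vector of minimum weight 5 = 1 mod 4 serves as s; B_5 = 1 makes 153 - 16 alpha - beta odd. *)
  have [[s sS [_ ws]] _] := Smin.
  by have := parityB s sS; rewrite ws => /(_ erefl B1); lia.
move=> /(_ 20%N isT isT)/agree_upto_dropr/(_ 16%N isT isT) WS.
have B1 : (B 1%N)%:Z = 0 by rewrite coefB WS // !coefE /=; ring.
have B5 : (B 5%N)%:Z = 0 by rewrite coefB WS // !coefE /=; ring.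
have B9 : (B 9%N)%:Z = alpha by rewrite coefB WS // !coefE /=; ring.
have B13 : (B 13%N)%:Z = - 16 * alpha - beta.
  by rewrite coefB WS // !coefE /=; ring.
have witness i : B i != 0%N -> exists2 s, s \in shadow C & wt s = i.
  by rewrite cards_eq0 => /set0Pn[s]; rewrite inE => /andP[sS /eqP]; exists s.
(* If B_9 = B_13 = 0 then alpha = beta = 0; otherwise S has a vector of weight 9 or 13. *)
have [B9_0|/witness[s sS ws]] := eqVneq (B 9%N) 0%N; last first.
  by have := parityB s sS; rewrite ws => /(_ erefl B1); lia.
have [B13_0|/witness[s sS ws]] := eqVneq (B 13%N) 0%N; last first.
  by have := parityB s sS; rewrite ws => /(_ erefl B1); lia.
lia.
Qed.
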